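(* Let $\beta: I\to M\subset G^3$ be a unit-speed curve on a surface $M$ in the Galilean space $G^3$ which is a geodesic ($\kappa_g\equiv0$) and a circular helix (its curvature $\kappa$ and torsion $\tau$ are both positive constants). Then there are real constants $c\neq0$, $c_1,e,e_1,e_2,e_3,f_1,f_2,f_3$ such that for all $x\in I$ $$\beta(x)=\Big(x,\ -\frac{e}{c^2}\cos(cx+c_1)+e_1x^2+e_2x+e_3,\ \frac{e}{c^2}\sin(cx+c_1)+f_1x^2+f_2x+f_3\Big).$$
   Context: The Galilean space $G^3$ is $\mathbb R^3$ with the scalar product $\mathbf v\cdot_G\mathbf w=v_1w_1$ if $v_1\ne0$ or $w_1\neq 0$, and $\mathbf v\cdot_G\mathbf w=v_2w_2+v_3w_3$ if $v_1=w_1=0$; the norm is $\|\mathbf v\|_G=\sqrt{|\mathbf v\cdot_G\mathbf v|}$ and the cross product is $\mathbf v\times_G\mathbf w=(0,\,v_3w_1-v_1w_3,\,v_1w_2-v_2w_1)$. A vector is isotropic if its first component is $0$. All objects are smooth and $I\subset\mathbb R$ is an open interval. $M$ is an oriented surface with local parametrizations $\phi(u,v)$ such that the first components of $\phi_u,\phi_v$ are not both zero; its unit normal is the isotropic vector field $\mathbf n=\pm\,\phi_u\times_G\phi_v/\|\phi_u\times_G\phi_v\|_G$ (sign fixed by the orientation). A unit-speed curve (parametrized by arc length) is one of the form $\beta(x)=(x,y(x),z(x))$, $x\in I$. Its curvature is $\kappa=\|\beta''\|_G$, assumed positive, and its torsion is $\tau=\det(\beta',\beta'',\beta''')/\kappa^2$.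 Its Darboux frame with respect to $M$ is $\{\mathbf T,\mathbf Q,\mathbf n\}$ with $\mathbf T=\beta'$, $\mathbf n$ the unit normal of $M$ along $\beta$, and $\mathbf Q=\mathbf T\times_G\mathbf n$. The functions $\kappa_g=\mathbf T'\cdot_G\mathbf Q$, $\kappa_n=\mathbf T'\cdot_G\mathbf n$, $\tau_g=\mathbf Q'\cdot_G\mathbf n$ are the geodesic curvature, normal curvature and geodesic torsion. *)

(* Defs.v *)
From HB Require Import structures.
From mathcomp Require Import all_boot all_order all_algebra.
From mathcomp Require Import all_classical all_reals all_analysis.

Set Implicit Arguments.
Unset Strict Implicit.
Unset Printing Implicit Defensive.

Import Order.TTheory GRing.Theory Num.Theory numFieldNormedType.Exports.

Local Open Scope classical_set_scope.
Local Open Scope ring_scope.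

(* The Galilean space G^3 is carried by 'rV[R]_3; the coordinates of v are
   v 0 0, v 0 1 and v 0 2, numbered from 0. *)
Definition vec3 (R : realType) (a b c : R) : 'rV[R]_3 :=
  \row_(j < 3) [:: a; b; c]`_j.

Definition gdot (R : realType) (v w : 'rV[R]_3) : R :=
  if (v 0 0 != 0) || (w 0 0 != 0) then v 0 0 * w 0 0
  else v 0 1 * w 0 1 + v 0 2 * w 0 2.

Definition gnorm (R : realType) (v : 'rV[R]_3) : R := Num.sqrt `|gdot v v|.

Definition gcross (R : realType) (v w : 'rV[R]_3) : 'rV[R]_3 :=
  vec3 0 (v 0 2 * w 0 0 - v 0 0 * w 0 2) (v 0 0 * w 0 1 - v 0 1 * w 0 0).

Definition det3 (R : realType) (a b c : 'rV[R]_3) : R :=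
  \det (\matrix_(i < 3) [:: a; b; c]`_i).

(* C^oo on the open set U: every iterated directional derivative is
   differentiable in every direction, and continuous, at every point of U. *)
Definition smooth_on (R : realType) (V W : normedModType R)
    (U : set V) (f : V -> W) : Prop :=
  forall (vs : seq V) (p : V), U p ->
    let g := foldr (fun v h => 'D_v h) f vs in
    {for p, continuous g} /\ forall v, derivable g p v.

Definition partial_u (R : realType) (phi : R * R -> 'rV[R]_3) (p : R * R) :
  'rV[R]_3 := 'D_((1, 0) : R * R) phi p.

Definition partial_v (R : realType) (phi : R * R -> 'rV[R]_3) (p : R * R) :
  'rV[R]_3 := 'D_((0, 1) : R * R) phi p.

(* Local parametrizations of a regular surface M of R^3: immersions that are
   homeomorphisms onto a relatively open part of M, and whose tangent planes
   are never the Euclidean plane of isotropic vectors. *)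
Record local_parametrization (R : realType) (M : set 'rV[R]_3)
    (U : set (R * R)) (phi : R * R -> 'rV[R]_3) : Prop := LocalParametrization {
  lp_open : open U ;
  lp_smooth : smooth_on U phi ;
  lp_image : exists2 W : set 'rV[R]_3, open W & phi @` U = M `&` W ;
  lp_homeo : exists2 psi : 'rV[R]_3 -> R * R,
    (forall p, U p -> psi (phi p) = p) & {within phi @` U, continuous psi} ;
  lp_regular : forall p, U p ->
    row_free (col_mx (partial_u phi p) (partial_v phi p)) ;
  lp_admissible : forall p, U p ->
    (partial_u phi p 0 0 != 0) || (partial_v phi p 0 0 != 0) }.

Definition param_normal (R : realType) (phi : R * R -> 'rV[R]_3) (p : R * R) :
    'rV[R]_3 :=
  let N := gcross (partial_u phi p) (partial_v phi p) in (gnorm N)^-1 *: N.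

(* The orientation is recorded by the unit normal field it selects: around each
   point there is a parametrization on which the sign is constant, which makes
   the field smooth on the surface.  Values off the surface are irrelevant. *)
Record oriented_surface (R : realType) := OrientedSurface {
  carrier : set 'rV[R]_3 ;
  unit_normal : 'rV[R]_3 -> 'rV[R]_3 ;
  surface_chart : forall q, carrier q ->
    exists (U : set (R * R)) (phi : R * R -> 'rV[R]_3) (s : bool),
      [/\ local_parametrization carrier U phi,
          (phi @` U) q
        & forall p, U p -> unit_normal (phi p) = (-1) ^+ s *: param_normal phi p]
  }.

Definition smooth_curve_on (R : realType) (I : set R) (beta : R -> 'rV[R]_3) :
    Prop :=
  forall (n : nat) (x : R), I x -> derivable (derive1n n beta) x 1.

Definition unit_speed_on (R : realType) (I : set R) (beta : R -> 'rV[R]_3) :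
    Prop :=
  forall x, I x -> beta x 0 0 = x.

Definition curvature (R : realType) (beta : R -> 'rV[R]_3) (x : R) : R :=
  gnorm (derive1n 2 beta x).

Definition torsion (R : realType) (beta : R -> 'rV[R]_3) (x : R) : R :=
  det3 (derive1 beta x) (derive1n 2 beta x) (derive1n 3 beta x) / curvature beta x ^+ 2.

Definition darbouxT (R : realType) (beta : R -> 'rV[R]_3) : R -> 'rV[R]_3 :=
  derive1 beta.

Definition darbouxN (R : realType) (M : oriented_surface R)
    (beta : R -> 'rV[R]_3) (x : R) : 'rV[R]_3 :=
  unit_normal M (beta x).

Definition darbouxQ (R : realType) (M : oriented_surface R)
    (beta : R -> 'rV[R]_3) (x : R) : 'rV[R]_3 :=
  gcross (darbouxT beta x) (darbouxN M beta x).

Definition geodesic_curvature (R : realType) (M : oriented_surface R)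
    (beta : R -> 'rV[R]_3) (x : R) : R :=
  gdot (derive1 (darbouxT beta) x) (darbouxQ M beta x).

Definition geodesic_on (R : realType) (M : oriented_surface R) (I : set R)
    (beta : R -> 'rV[R]_3) : Prop :=
  forall x, I x -> geodesic_curvature M beta x = 0.

Definition circular_helix_on (R : realType) (I : set R)
    (beta : R -> 'rV[R]_3) : Prop :=
  exists kappa tau : R, [/\ 0 < kappa, 0 < tau &
    forall x, I x -> curvature beta x = kappa /\ torsion beta x = tau].

(* Main.v *)
Require Import Defs.
From HB Require Import structures.
From mathcomp Require Import all_boot all_order all_algebra.
From mathcomp Require Import all_classical all_reals all_analysis.
From mathcomp Require Import ring lra.
Import Order.TTheory GRing.Theory Num.Theory numFieldNormedType.Exports.
Local Open Scope classical_set_scope.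
Local Open Scope ring_scope.

(** Write p = y'' and q = z''.  Since beta''
is isotropic, constant curvature and torsion say p^2 + q^2 = k^2 and
p q' - q p' = t k^2; with the derivative of the first equation this gives
p' = - t q and q' = t p, so (p, q) = k (cos (t x + d), sin (t x + d)) for some d.
Integrating twice gives the claim with c = - t, c1 = - d, e = k, e1 = f1 = 0. *)

Lemma is_derive_mx_coord (R : realFieldType) (V : normedModType R) (m n : nat)
    (M : V -> 'M[R]_(m, n)) (t v : V) (i : 'I_m) (j : 'I_n) :
  derivable M t v -> is_derive t v (fun s => M s i j) ('D_v M t i j).
Proof.
move=> dM; apply: DeriveDef; first by move/derivable_mxP: dM; exact.
by rewrite derive_mx// mxE.
Qed.

Lemma is_derive_curve_coord (R : realType) (I : set R) (beta : R -> 'rV[R]_3)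
    (n : nat) (j : 'I_3) (x : R) :
  smooth_curve_on I beta -> I x ->
  is_derive x 1 (fun t => derive1n n beta t 0 j) (derive1n n.+1 beta x 0 j).
Proof.
move=> sm Ix; rewrite derive1nS derive1E.
exact: is_derive_mx_coord (sm n x Ix).
Qed.

(** Openness of [I] makes the two functions agree near [x]. This is what allows an identity valid
    only on [I] to be differentiated there. *)
Lemma is_derive_eq_on_open (R : realType) (I : set R) (f g : R -> R)
    (x a b : R) :
  open I -> I x -> (forall t, I t -> f t = g t) ->
  is_derive x 1 f a -> is_derive x 1 g b -> a = b.
Proof.
move=> oI Ix fg [_ <-] [_ <-]; apply: near_eq_derive.
by near do apply: fg; exact: open_nbhs_nbhs.
Unshelve. all: by end_near. Qed.

Lemma derive0_const_on_interval (R : realType) (I : set R) (f : R -> R) :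
  is_interval I -> (forall x, I x -> is_derive x 1 f 0) ->
  forall x y, I x -> I y -> f x = f y.
Proof.
move=> itvI df x y.
wlog xy : x y / x <= y => [wl Ix Iy|Ix Iy].
  by case: (leP x y) => [xy|/ltW yx]; [exact: wl|apply/esym; exact: wl].
have sub z : z \in `[x, y] -> I z.
  by rewrite in_itv/= => zxy; exact: itvI Ix Iy _ zxy.
have [z||c _] := @MVT_segment R f (fun=> 0) x y xy.
- by rewrite inE/= => zxy; apply/df/sub; exact: subset_itv_oo_cc zxy.
- apply: derivable_within_continuous => z zxy.
  by have := df _ (sub _ zxy); case.
- by rewrite mul0r => /subr0_eq.
Qed.

Lemma derive2_0_affine_on_interval (R : realType) (I : set R) (f df : R -> R) :
  is_interval I -> (forall x, I x -> is_derive x 1 f (df x)) ->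
  (forall x, I x -> is_derive x 1 df 0) ->
  exists a b, forall x, I x -> f x = a * x + b.
Proof.
move=> itvI dfE ddf.
have [[x0 Ix0]|noI] := pselect (exists x, I x); last first.
  by exists 0, 0 => x Ix; case: noI; exists x.
exists (df x0), (f x0 - df x0 * x0) => x Ix.
(* The slope [df] is constant, so removing the line of slope [df x0] leaves a function with zero
   derivative. *)
have dg t : I t -> is_derive t 1 (fun s => f s - df x0 * s) 0.
  move=> It; have dft := dfE _ It.
  apply: is_derive_eq.
  rewrite (derive0_const_on_interval _ _ _ itvI ddf _ _ It Ix0).
  by rewrite /GRing.scale/= !mulr1 subrr.
rewrite -(derive0_const_on_interval _ _ _ itvI dg _ _ Ix Ix0).
by rewrite addrC subrK.
Qed.

(** The angle [acos (a / k)] has the right cosine, and its sine is [|b| / k]; the sign of [b] then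
    decides between this angle and its opposite. *)
Lemma polar_angle (R : realType) (k a b : R) :
  0 < k -> a ^+ 2 + b ^+ 2 = k ^+ 2 ->
  exists d, a = k * cos d /\ b = k * sin d.
Proof.
move=> k0 abk.
have kne : k != 0 by rewrite gt_eqF.
have ak1 : -1 <= a / k <= 1.
  rewrite ler_pdivlMr// ler_pdivrMr// mulN1r mul1r.
  have b2 := sqr_ge0 b; apply/andP; split; nra.
have sinE : sin (acos (a / k)) = `|b| / k.
  rewrite sin_acos//; have -> : 1 - (a / k) ^+ 2 = (b / k) ^+ 2.
    rewrite !exprMn exprVn; apply: (mulIf (expf_neq0 2 kne)).
    by rewrite mulrBl mul1r !mulfVK ?expf_neq0//; lra.
  by rewrite sqrtr_sqr normrM normfV (gtr0_norm k0).
have cosE : cos (acos (a / k)) = a / k by rewrite acosK// in_itv.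
case: (leP 0 b) => b0.
  exists (acos (a / k)); rewrite cosE sinE ger0_norm//.
  by rewrite ![k * _]mulrC !mulfVK.
exists (- acos (a / k)); rewrite cosN sinN cosE sinE ltr0_norm//.
by rewrite mulNr opprK ![k * _]mulrC !mulfVK.
Qed.

Lemma uniform_rotation (R : realType) (I : set R) (p q : R -> R) (k t : R) :
  is_interval I -> 0 < k ->
  (forall x, I x -> p x ^+ 2 + q x ^+ 2 = k ^+ 2) ->
  (forall x, I x -> is_derive x 1 p (- t * q x)) ->
  (forall x, I x -> is_derive x 1 q (t * p x)) ->
  exists d, forall x, I x ->
    p x = k * cos (t * x + d) /\ q x = k * sin (t * x + d).
Proof.
move=> itvI k0 pqk dp dq.
have [[x0 Ix0]|noI] := pselect (exists x, I x); last first.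
  by exists 0 => x Ix; case: noI; exists x.
(* (p, q) turned back by the angle [t x] is constant. *)
pose a x := p x * cos (t * x) + q x * sin (t * x).
pose b x := q x * cos (t * x) - p x * sin (t * x).
have da x : I x -> is_derive x 1 a 0.
  move=> Ix; have dpx := dp _ Ix; have dqx := dq _ Ix.
  apply: is_derive_eq; rewrite /GRing.scale/=; ring.
have db x : I x -> is_derive x 1 b 0.
  move=> Ix; have dpx := dp _ Ix; have dqx := dq _ Ix.
  apply: is_derive_eq; rewrite /GRing.scale/=; ring.
have ca := derive0_const_on_interval _ _ _ itvI da.
have cb := derive0_const_on_interval _ _ _ itvI db.
(* Rotations preserve length, so the constant vector (a, b) still has norm [k]; its polar angle is
   the phase [d]. *)
have [|d [ad bd]] := polar_angle _ k (a x0) (b x0) k0.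
  rewrite -(pqk _ Ix0) /a /b.
  rewrite -[RHS]mulr1 -(cos2Dsin2 (t * x0)); ring.
exists d => x Ix.
rewrite cosD sinD.
have -> : k * (cos (t * x) * cos d - sin (t * x) * sin d) =
          a x * cos (t * x) - b x * sin (t * x).
  by rewrite (ca _ _ Ix Ix0) (cb _ _ Ix Ix0) ad bd; ring.
have -> : k * (sin (t * x) * cos d + cos (t * x) * sin d) =
          a x * sin (t * x) + b x * cos (t * x).
  by rewrite (ca _ _ Ix Ix0) (cb _ _ Ix Ix0) ad bd; ring.
(* Turning (a, b) forward by the angle [t * x] must return (p, q); the factor 1, written as cos^2 +
   sin^2, makes each equation a polynomial identity. *)
rewrite /a /b; split.
  by rewrite -[LHS]mulr1 -(cos2Dsin2 (t * x)); ring.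
by rewrite -[LHS]mulr1 -(cos2Dsin2 (t * x)); ring.
Qed.

(** Only [a] contributes to the expansion along the first column. For a unit-speed curve this turns
    the numerator of the torsion into the planar expression p q' - q p'. *)
Lemma det3_isotropic (R : realType) (a b c : 'rV[R]_3) :
  b 0 0 = 0 -> c 0 0 = 0 ->
  det3 a b c = a 0 0 * (b 0 1 * c 0 2 - b 0 2 * c 0 1).
Proof.
move=> b0 c0; rewrite /det3 (expand_det_col _ 0) !big_ord_recl big_ord0.
rewrite !mxE /= b0 c0 !mul0r !addr0; congr (_ * _).
rewrite /cofactor /= expr0 mul1r (expand_det_row _ 0) !big_ord_recl big_ord0.
rewrite /cofactor !det_mx11 !mxE /= -[bump 0 0]/1%N addr0 expr0 expr1 mul1r mulN1r mulrN.
by congr (b _ _ * c _ _ - b _ _ * c _ _); apply/val_inj.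
Qed.

Lemma gnorm_isotropic (R : realType) (v : 'rV[R]_3) :
  v 0 0 = 0 -> Defs.gnorm v ^+ 2 = v 0 1 ^+ 2 + v 0 2 ^+ 2.
Proof.
move=> v0; rewrite /Defs.gnorm /gdot v0 eqxx /= sqr_sqrtr// -!expr2 ger0_norm//.
by rewrite addr_ge0 ?sqr_ge0.
Qed.

(** The vector (p', q') is resolved in the orthogonal frame (p, q), (-q, p): constant length kills
    the first component, and the last hypothesis prescribes the second. *)
Lemma plane_derive_frame (R : realType) (I : set R) (p q : R -> R)
    (x k p' q' t : R) :
  open I -> I x -> 0 < k ->
  (forall s, I s -> p s ^+ 2 + q s ^+ 2 = k ^+ 2) ->
  is_derive x 1 p p' -> is_derive x 1 q q' ->
  p x * q' - q x * p' = t * k ^+ 2 ->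
  p' = - t * q x /\ q' = t * p x.
Proof.
move=> oI Ix k0 pqk dp dq wr.
have k2 : k ^+ 2 != 0 by rewrite expf_neq0// gt_eqF.
have orth : p x * p' + q x * q' = 0.
  have dpq : is_derive x 1 (fun s => p s ^+ 2 + q s ^+ 2)
      (2 * (p x * p' + q x * q')).
    by apply: is_derive_eq; rewrite /GRing.scale/=; ring.
  have := is_derive_eq_on_open _ I _ (cst (k ^+ 2)) x _ _ oI Ix pqk dpq
    (is_derive_cst _ x 1).
  by move/eqP; rewrite mulf_eq0 pnatr_eq0 /= => /eqP.
(* Multiplying by k^2 = p^2 + q^2 expresses p' and q' through the two inner products with the
   frame. *)
split; apply: (mulfI k2).
  have -> : k ^+ 2 * p' = p x * (p x * p' + q x * q') -
      q x * (p x * q' - q x * p') by rewrite -(pqk x Ix); ring.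
  by rewrite orth wr; ring.
have -> : k ^+ 2 * q' = q x * (p x * p' + q x * q') +
    p x * (p x * q' - q x * p') by rewrite -(pqk x Ix); ring.
by rewrite orth wr; ring.
Qed.

Section UnitSpeedCurve.
Context (R : realType) (I : set R) (beta : R -> 'rV[R]_3)
  (I_open : open I) (beta_smooth : smooth_curve_on I beta)
  (beta_unit : unit_speed_on I beta).

Let dcoord n j x (Ix : I x) :=
  is_derive_curve_coord R I beta n j x beta_smooth Ix.

(** Differentiating the first coordinate [x] repeatedly gives 1, 0, 0. Hence the second and third
    derivatives are isotropic, as the formulas for norm and determinant require. *)
Lemma unit_speed_derive1 x : I x -> derive1n 1 beta x 0 0 = 1.
Proof.
move=> Ix; exact: (is_derive_eq_on_open _ I _ id x _ _ I_open Ix beta_unit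
  (dcoord 0%N 0 x Ix) (is_derive_id x 1)).
Qed.

Lemma unit_speed_derive2 x : I x -> derive1n 2 beta x 0 0 = 0.
Proof.
move=> Ix; exact: (is_derive_eq_on_open _ I _ (cst 1) x _ _ I_open Ix
  unit_speed_derive1 (dcoord 1%N 0 x Ix) (is_derive_cst _ x 1)).
Qed.

Lemma unit_speed_derive3 x : I x -> derive1n 3 beta x 0 0 = 0.
Proof.
move=> Ix; exact: (is_derive_eq_on_open _ I _ (cst 0) x _ _ I_open Ix
  unit_speed_derive2 (dcoord 2%N 0 x Ix) (is_derive_cst _ x 1)).
Qed.

(** These are the Frenet equations of the curve read in the isotropic plane: the curvature fixes the
    length of (y'', z''), the torsion its angular speed. *)
Lemma helix_derive3 (k t : R) : 0 < k ->
  (forall x, I x -> curvature beta x = k /\ torsion beta x = t) ->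
  forall x, I x ->
    [/\ derive1n 2 beta x 0 1 ^+ 2 + derive1n 2 beta x 0 2 ^+ 2 = k ^+ 2,
        derive1n 3 beta x 0 1 = - t * derive1n 2 beta x 0 2 &
        derive1n 3 beta x 0 2 = t * derive1n 2 beta x 0 1].
Proof.
move=> k0 kt.
have pqk x : I x ->
    derive1n 2 beta x 0 1 ^+ 2 + derive1n 2 beta x 0 2 ^+ 2 = k ^+ 2.
  by move=> Ix; rewrite -(kt x Ix).1 /curvature gnorm_isotropic ?unit_speed_derive2.
move=> x Ix; suff [h1 h2] : derive1n 3 beta x 0 1 = - t * derive1n 2 beta x 0 2 /\
    derive1n 3 beta x 0 2 = t * derive1n 2 beta x 0 1 by split=> //; exact: pqk.
have [kx] := kt x Ix; rewrite /torsion kx.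
have := unit_speed_derive1 x Ix; rewrite derive1n1.
have := unit_speed_derive2 x Ix; have := unit_speed_derive3 x Ix.
have d1 := dcoord 2%N 1 x Ix; have d2 := dcoord 2%N 2 x Ix.
move: (plane_derive_frame _ _ _ _ _ _ _ _ t I_open Ix k0 pqk d1 d2).
move: (derive1 beta x) (derive1n 2 beta x) (derive1n 3 beta x) => a b c.
move=> frame c0 b0 a0; rewrite det3_isotropic// a0 mul1r => tE.
by apply: frame; rewrite -tE mulfVK// expf_neq0// gt_eqF.
Qed.

End UnitSpeedCurve.

Theorem corollary4p3 (R : realType) (M : oriented_surface R)
    (I : set R) (beta : R -> 'rV[R]_3)
    (I_open : open I) (I_itv : is_interval I)
    (beta_smooth : smooth_curve_on I beta)
    (beta_M : forall x, I x -> carrier M (beta x))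
    (beta_unit : unit_speed_on I beta)
    (beta_geodesic : geodesic_on M I beta)
    (beta_helix : circular_helix_on I beta) :
  exists c c1 e e1 e2 e3 f1 f2 f3 : R, c != 0 /\
    forall x, I x ->
      beta x = vec3 x
        (- (e / c ^+ 2) * cos (c * x + c1) + e1 * x ^+ 2 + e2 * x + e3)
        (e / c ^+ 2 * sin (c * x + c1) + f1 * x ^+ 2 + f2 * x + f3).
Proof.
have [k [t [k0 t0 kt]]] := beta_helix.
have tne : t != 0 by rewrite gt_eqF.
have hel := helix_derive3 _ _ _ I_open beta_smooth beta_unit _ _ k0 kt.
have dc n j x (Ix : I x) := is_derive_curve_coord R I beta n j x beta_smooth Ix.
have [d pqd] : exists d, forall x, I x ->
    derive1n 2 beta x 0 1 = k * cos (t * x + d) /\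
    derive1n 2 beta x 0 2 = k * sin (t * x + d).
  apply: (uniform_rotation _ _ (fun x => derive1n 2 beta x 0 1)
    (fun x => derive1n 2 beta x 0 2)) => // x Ix; have [h1 h2 h3] := hel x Ix.
  - exact: h1.
  - by rewrite -h2; exact: dc.
  - by rewrite -h3; exact: dc.
(* Adding [k / t ^+ 2 * cos (t * x + d)] cancels the second derivative of the coordinate, so an
   affine function remains; the third coordinate is treated alike with the sine. *)
have [e2 [e3 yE]] : exists a b, forall x, I x ->
    beta x 0 1 + k / t ^+ 2 * cos (t * x + d) = a * x + b.
  apply: (derive2_0_affine_on_interval _ _ _
    (fun x => derive1n 1 beta x 0 1 - k / t * sin (t * x + d))) => // x Ix.
    have d0 := dc 0%N 1 x Ix.
    by apply: is_derive_eq; rewrite /GRing.scale/=; field.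
  have d1 := dc 1%N 1 x Ix.
  by apply: is_derive_eq; rewrite /GRing.scale/= (pqd x Ix).1; field.
have [f2 [f3 zE]] : exists a b, forall x, I x ->
    beta x 0 2 + k / t ^+ 2 * sin (t * x + d) = a * x + b.
  apply: (derive2_0_affine_on_interval _ _ _
    (fun x => derive1n 1 beta x 0 2 + k / t * cos (t * x + d))) => // x Ix.
    have d0 := dc 0%N 2 x Ix.
    by apply: is_derive_eq; rewrite /GRing.scale/=; field.
  have d1 := dc 1%N 2 x Ix.
  by apply: is_derive_eq; rewrite /GRing.scale/= (pqd x Ix).2; field.
(* Integration gives a minus sign before both cosine and sine, while the claim has a plus before the
   sine. Reversing the angle flips the sine and keeps both the cosine and [c ^+ 2]. *)
exists (- t), (- d), k, 0, e2, e3, 0, f2, f3; split; first by rewrite oppr_eq0.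
move=> x Ix; rewrite [- t * x]mulNr -opprD cosN sinN sqrrN !mul0r !addr0.
apply/rowP => -[[|[|[|//]]] jlt]; rewrite mxE /=.
- by rewrite -[RHS](beta_unit x Ix); congr (beta x _ _); apply/val_inj.
- have -> : Ordinal jlt = 1 by apply/val_inj.
  by rewrite -addrA -(yE x Ix) mulNr addrC addrK.
- have -> : Ordinal jlt = 2 by apply/val_inj.
  by rewrite -addrA -(zE x Ix) mulrN addrC addrK.
Qed.
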